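(* The exponential generating function of the higher order Horadam 3-parameter generalized quaternions is $$\sum_{n\geq 0}\mathbf{Q}W_{n}(s)\frac{\lambda^{n}}{n!}=\frac{A\Theta_{\alpha}(s)e^{\alpha^{s}\lambda}-B\Theta_{\beta}(s)e^{\beta^{s}\lambda}}{A\alpha^{s}-B\beta^{s}}.$$
   Context: Let $\alpha,\beta$ be distinct nonzero real numbers, $W_0,W_1$ real numbers, $A=W_1-W_0\beta$, $B=W_1-W_0\alpha$, and let $W_n=\frac{A\alpha^n-B\beta^n}{\alpha-\beta}$ ($n\geq 0$) be the Horadam numbers. Fix an integer $s\geq 1$ with $W_s\neq 0$, equivalently $A\alpha^s-B\beta^s\neq 0$. The higher order Horadam numbers are $W_n(s)=\frac{W_{sn}}{W_s}=\frac{A\alpha^{sn}-B\beta^{sn}}{A\alpha^s-B\beta^s}$, $n\geq 0$. Let $\lambda_1,\lambda_2,\lambda_3$ be real parameters. The 3-parameter generalized quaternions form the real algebra of elements $x_0\mathbf{1}+x_1\mathbf{i}+x_2\mathbf{j}+x_3\mathbf{k}$ ($x_r\in\mathbb{R}$) with basis $\mathbf{1},\mathbf{i},\mathbf{j},\mathbf{k}$ and bilinear multiplication in which $\mathbf{1}$ is the identity and $\mathbf{i}^2=-\lambda_1\lambda_2\mathbf{1}$, $\mathbf{j}^2=-\lambda_1\lambda_3\mathbf{1}$, $\mathbf{k}^2=-\lambda_2\lambda_3\mathbf{1}$, $\mathbf{i}\mathbf{j}=\lambda_1\mathbf{k}=-\mathbf{j}\mathbf{i}$, $\mathbf{j}\mathbf{k}=\lambda_3\mathbf{i}=-\mathbf{k}\mathbf{j}$,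 $\mathbf{k}\mathbf{i}=\lambda_2\mathbf{j}=-\mathbf{i}\mathbf{k}$. The higher order Horadam 3-parameter generalized quaternions are $\mathbf{Q}W_n(s)=W_n(s)\mathbf{1}+W_{n+1}(s)\mathbf{i}+W_{n+2}(s)\mathbf{j}+W_{n+3}(s)\mathbf{k}$, $n\geq 0$. Put $\Theta_{\alpha}(s)=\mathbf{1}+\alpha^{s}\mathbf{i}+\alpha^{2s}\mathbf{j}+\alpha^{3s}\mathbf{k}$ and $\Theta_{\beta}(s)=\mathbf{1}+\beta^{s}\mathbf{i}+\beta^{2s}\mathbf{j}+\beta^{3s}\mathbf{k}$. Here $\lambda$ is a real variable (unrelated to $\lambda_1,\lambda_2,\lambda_3$), and the series is summed coordinatewise in the basis $\mathbf{1},\mathbf{i},\mathbf{j},\mathbf{k}$. *)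

(* Defs.v *)
From HB Require Import structures.
From mathcomp Require Import all_boot all_order all_algebra ring.
From mathcomp Require Import all_classical all_reals all_analysis.

Set Implicit Arguments.
Unset Strict Implicit.
Unset Printing Implicit Defensive.

Import Order.TTheory GRing.Theory Num.Theory.
Import numFieldNormedType.Exports.

Local Open Scope classical_set_scope.
Local Open Scope ring_scope.

(* The coordinates do not depend on l1 l2 l3; these parameters only select the
   multiplication. *)
Record gquat (R : realType) (l1 l2 l3 : R) : Type :=
  GQuat { q0 : R; q1 : R; q2 : R; q3 : R }.

Section GQuatAlgebra.
Variables (R : realType) (l1 l2 l3 : R).
Local Notation Q := (gquat l1 l2 l3).
Local Notation mk := (@GQuat R l1 l2 l3).

Definition gquat_tuple (x : Q) : R * R * R * R := (q0 x, q1 x, q2 x, q3 x).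
Definition tuple_gquat (t : R * R * R * R) : Q :=
  mk t.1.1.1 t.1.1.2 t.1.2 t.2.

Lemma gquat_tupleK : cancel gquat_tuple tuple_gquat.
Proof. by case. Qed.

HB.instance Definition _ := Choice.copy Q (can_type gquat_tupleK).

Definition addq (x y : Q) : Q :=
  mk (q0 x + q0 y) (q1 x + q1 y) (q2 x + q2 y) (q3 x + q3 y).
Definition oppq (x : Q) : Q := mk (- q0 x) (- q1 x) (- q2 x) (- q3 x).

(* Bilinear extension of the table proved in [gquat_table] below. *)
Definition mulq (x y : Q) : Q :=
  mk (q0 x * q0 y - l1 * l2 * (q1 x * q1 y) - l1 * l3 * (q2 x * q2 y)
        - l2 * l3 * (q3 x * q3 y))
     (q0 x * q1 y + q1 x * q0 y + l3 * (q2 x * q3 y - q3 x * q2 y))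
     (q0 x * q2 y + q2 x * q0 y + l2 * (q3 x * q1 y - q1 x * q3 y))
     (q0 x * q3 y + q3 x * q0 y + l1 * (q1 x * q2 y - q2 x * q1 y)).

Definition scaleq (a : R) (x : Q) : Q :=
  mk (a * q0 x) (a * q1 x) (a * q2 x) (a * q3 x).

Local Ltac qring :=
  repeat case=> ? ? ? ?; rewrite /addq /oppq /mulq /scaleq /=;
  congr GQuat; ring.

Lemma addqA : associative addq. Proof. qring. Qed.
Lemma addqC : commutative addq. Proof. qring. Qed.
Lemma add0q : left_id (mk 0 0 0 0) addq. Proof. qring. Qed.
Lemma addNq : left_inverse (mk 0 0 0 0) oppq addq. Proof. qring. Qed.

HB.instance Definition _ := GRing.isZmodule.Build Q addqA addqC add0q addNq.

Lemma mulqA : associative mulq. Proof. qring. Qed.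
Lemma mul1q : left_id (mk 1 0 0 0) mulq. Proof. qring. Qed.
Lemma mulq1 : right_id (mk 1 0 0 0) mulq. Proof. qring. Qed.
Lemma mulqDl : left_distributive mulq addq. Proof. qring. Qed.
Lemma mulqDr : right_distributive mulq addq. Proof. qring. Qed.
Lemma oneq_neq0 : mk 1 0 0 0 != 0.
Proof. by apply/eqP => -[] /eqP; rewrite oner_eq0. Qed.

HB.instance Definition _ :=
  GRing.Zmodule_isNzRing.Build Q mulqA mul1q mulq1 mulqDl mulqDr oneq_neq0.

Lemma scaleqA a b (x : Q) : scaleq a (scaleq b x) = scaleq (a * b) x.
Proof. by move: x; qring. Qed.
Lemma scale1q : left_id 1 scaleq. Proof. by qring. Qed.
Lemma scaleqDr : right_distributive scaleq addq.
Proof. by move=> a; qring. Qed.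
Lemma scaleqDl (x : Q) : {morph scaleq^~ x : a b / a + b >-> addq a b}.
Proof. by move=> a b; move: x; qring. Qed.

HB.instance Definition _ :=
  GRing.Zmodule_isLmodule.Build R Q scaleqA scale1q scaleqDr scaleqDl.

Lemma scaleqAl (a : R) (x y : Q) : a *: (x * y) = (a *: x) * y.
Proof. by congr GQuat => /=; ring. Qed.

HB.instance Definition _ := GRing.Lmodule_isLalgebra.Build R Q scaleqAl.

Lemma scaleqAr (a : R) (x y : Q) : a *: (x * y) = x * (a *: y).
Proof. by congr GQuat => /=; ring. Qed.

HB.instance Definition _ := GRing.Lalgebra_isAlgebra.Build R Q scaleqAr.

Definition qi : Q := mk 0 1 0 0.
Definition qj : Q := mk 0 0 1 0.
Definition qk : Q := mk 0 0 0 1.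

Lemma gquat_basis (x : Q) :
  x = q0 x *: 1 + q1 x *: qi + q2 x *: qj + q3 x *: qk.
Proof. by case: x => a b c d; congr GQuat => /=; ring. Qed.

Lemma gquat_table :
  [/\ qi * qi = - (l1 * l2) *: 1, qj * qj = - (l1 * l3) *: 1
    & qk * qk = - (l2 * l3) *: 1] /\
  [/\ qi * qj = l1 *: qk, qj * qi = - (l1 *: qk),
      qj * qk = l3 *: qi & qk * qj = - (l3 *: qi)] /\
  [/\ qk * qi = l2 *: qj & qi * qk = - (l2 *: qj)].
Proof. by do ?split; congr GQuat => /=; ring. Qed.

End GQuatAlgebra.

Arguments qi {R l1 l2 l3}.
Arguments qj {R l1 l2 l3}.
Arguments qk {R l1 l2 l3}.

Definition gquat_series_sum (R : realType) (l1 l2 l3 : R)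
    (u : nat -> gquat l1 l2 l3) (S : gquat l1 l2 l3) : Prop :=
  [/\ series (fun n => q0 (u n)) @ \oo --> q0 S,
      series (fun n => q1 (u n)) @ \oo --> q1 S,
      series (fun n => q2 (u n)) @ \oo --> q2 S
    & series (fun n => q3 (u n)) @ \oo --> q3 S].

Section Horadam.
Variable R : realType.

Definition horadamA (beta W0 W1 : R) : R := W1 - W0 * beta.
Definition horadamB (alpha W0 W1 : R) : R := W1 - W0 * alpha.

Definition horadam (alpha beta W0 W1 : R) (n : nat) : R :=
  (horadamA beta W0 W1 * alpha ^+ n - horadamB alpha W0 W1 * beta ^+ n)
    / (alpha - beta).

Definition horadam_ho (alpha beta W0 W1 : R) (s n : nat) : R :=
  horadam alpha beta W0 W1 (s * n) / horadam alpha beta W0 W1 s.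

Definition horadam_quat (l1 l2 l3 alpha beta W0 W1 : R) (s n : nat) :
    gquat l1 l2 l3 :=
  horadam_ho alpha beta W0 W1 s n *: 1
  + horadam_ho alpha beta W0 W1 s n.+1 *: qi
  + horadam_ho alpha beta W0 W1 s n.+2 *: qj
  + horadam_ho alpha beta W0 W1 s n.+3 *: qk.

Definition Theta (l1 l2 l3 x : R) (s : nat) : gquat l1 l2 l3 :=
  1 + x ^+ s *: qi + x ^+ (2 * s) *: qj + x ^+ (3 * s) *: qk.

End Horadam.

(* Main.v *)
(* Binet's formula gives
   W_(n+k)(s) = (A a^k a^n - B b^k b^n) / (A a - B b) with a = alpha^s and
   b = beta^s, so the series of the k-th coordinate is a combination of the
   exponential series at a * lambda and b * lambda; the factors a^k and b^k are
   the coordinates of Theta_alpha(s) and Theta_beta(s). *)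
Require Import Defs.
From HB Require Import structures.
From mathcomp Require Import all_boot all_order all_algebra ring.
From mathcomp Require Import all_classical all_reals all_analysis.

Set Implicit Arguments.
Unset Strict Implicit.
Unset Printing Implicit Defensive.

Import Order.TTheory GRing.Theory Num.Theory.
Import numFieldNormedType.Exports.

Local Open Scope classical_set_scope.
Local Open Scope ring_scope.

Lemma cvg_series_expR (R : realType) (x : R) :
  series (exp_coeff x) @ \oo --> expR x.
Proof. exact: is_cvg_series_exp_coeff. Qed.

(** Both Horadam numbers in the quotient carry the factor [(alpha - beta)^-1], which cancels because
    [alpha != beta]. *)
Lemma horadam_hoE (R : realType) (alpha beta W0 W1 : R) (s n : nat) :
    alpha != beta ->
  let A := horadamA beta W0 W1 in
  let B := horadamB alpha W0 W1 in
  horadam_ho alpha beta W0 W1 s n =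
  (A * (alpha ^+ s) ^+ n - B * (beta ^+ s) ^+ n)
    / (A * alpha ^+ s - B * beta ^+ s).
Proof.
move=> neq_ab A B; rewrite /horadam_ho /horadam -/A -/B !exprM invfM invrK.
by rewrite mulrACA mulVf ?mulr1 // subr_eq0.
Qed.

(** Keeping the shift [k] general lets one statement serve all four coordinates, with [k] from 0 to
    3. *)
Lemma cvg_series_horadam_ho_shift (R : realType) (alpha beta W0 W1 lambda : R)
    (s k : nat) : alpha != beta ->
  let A := horadamA beta W0 W1 in
  let B := horadamB alpha W0 W1 in
  series (fun n => lambda ^+ n / n`!%:R * horadam_ho alpha beta W0 W1 s (n + k))
    @ \oo -->
  (A * alpha ^+ s - B * beta ^+ s)^-1 *
    (A * expR (alpha ^+ s * lambda) * alpha ^+ (k * s)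
     - B * expR (beta ^+ s * lambda) * beta ^+ (k * s)).
Proof.
move=> neq_ab A B; set D := A * _ - _.
pose a := D^-1 * A * alpha ^+ (k * s); pose b := D^-1 * B * beta ^+ (k * s).
rewrite [X in _ --> X](_ : _ =
  a * expR (alpha ^+ s * lambda) - b * expR (beta ^+ s * lambda)); last first.
  by rewrite /a /b; ring.
(* The identity holds already between finite partial sums, so linearity of limits suffices. *)
rewrite (_ : series _ = (fun n => a * series (exp_coeff (alpha ^+ s * lambda)) n
  - b * series (exp_coeff (beta ^+ s * lambda)) n)).
  by apply: cvgB; apply: cvgMl_tmp; exact: cvg_series_expR.
apply/funext => m; rewrite /series /= !mulr_sumr -sumrB.
apply: eq_bigr => n _; rewrite horadam_hoE // -/A -/B -/D /exp_coeff /=.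
(* With [s * k] in place of [k * s], the shift factors become powers of [alpha ^+ s] and
   [beta ^+ s], matching those split off from the exponent [n + k]. *)
rewrite /a /b !(mulnC k) !exprM !exprD !exprMn; ring.
Qed.

Theorem theorem5p3 (R : realType) (l1 l2 l3 : R) (alpha beta W0 W1 : R)
    (s : nat) (lambda : R)
    (alpha_neq0 : alpha != 0) (beta_neq0 : beta != 0)
    (alpha_neq_beta : alpha != beta)
    (s_ge1 : (1 <= s)%N) (Ws_neq0 : horadam alpha beta W0 W1 s != 0) :
  let A := horadamA beta W0 W1 in
  let B := horadamB alpha W0 W1 in
  gquat_series_sum
    (fun n => (lambda ^+ n / n`!%:R) *:
       horadam_quat l1 l2 l3 alpha beta W0 W1 s n)
    ((A * alpha ^+ s - B * beta ^+ s)^-1 *: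
       ((A * expR (alpha ^+ s * lambda)) *: Theta l1 l2 l3 alpha s
        - (B * expR (beta ^+ s * lambda)) *: Theta l1 l2 l3 beta s)).
Proof.
move=> A B.
have cvgW k := @cvg_series_horadam_ho_shift R alpha beta W0 W1 lambda s k
  alpha_neq_beta.
(* Leaves two algebraic identities per coordinate, one for the terms and one for the limit. *)
have cvg_eq (u v : nat -> R) (a b : R) :
  u =1 v -> a = b -> series u @ \oo --> a -> series v @ \oo --> b.
  by move=> /funext -> ->.
split; [apply: cvg_eq (cvgW 0%N)|apply: cvg_eq (cvgW 1%N)
       |apply: cvg_eq (cvgW 2%N)|apply: cvg_eq (cvgW 3%N)].
all: try move=> n; rewrite /= -/A -/B.
(* Only one of [1], [qi], [qj], [qk] contributes to each coordinate. *)
all: by rewrite ?addn0 ?addn1 ?addn2 ?addn3 ?mul0n ?mul1n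
  ?expr0 ?(mulr0, mulr1, addr0, add0r).
Qed.
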